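(* Let $\omega\in\mathbb R\setminus\{0\}$, $\delta\in(0,1)$ and $B>1$, and consider the dynamical system on the torus $$\frac{d\theta}{d\tau}=\frac{\cos\theta+B}{\omega(1-\delta\cos\tau)}$$ (the system $\frac{d\theta}{d\tau}=\frac{\cos\theta+B+A\sin\tau}{\omega(1-\delta\cos\tau)}+D$ with $A=D=0$). The monodromy $M$, along the counterclockwise unit circle $\{|z|=1\}$, of the corresponding linear system $$\frac{d}{dz}\begin{pmatrix}u\\ v\end{pmatrix}=\frac{1}{\omega(\delta(1+z^2)-2z)}\begin{pmatrix}2B&1\\ -1&0\end{pmatrix}\begin{pmatrix}u\\ v\end{pmatrix}$$ is trivial, i.e. a scalar multiple of the identity, if and only if $$B^2=\omega^2(1-\delta^2)n^2+1\quad\text{for some } n\in\mathbb Z.$$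
   Context: The linear system corresponds to the dynamical system as follows: under $\Phi=e^{i\theta}$, $z=e^{i\tau}$ the dynamical system becomes the Riccati equation $\frac{d\Phi}{dz}=-\frac{1+2B\Phi+\Phi^2}{\omega(\delta(1+z^2)-2z)}$, whose solutions are exactly the functions $\Phi=v/u$ for solutions $(u,v)$ of the linear system. *)

(* Defs.v *)
From Stdlib Require Import Reals Lra.
From Coquelicot Require Import Coquelicot.

Open Scope R_scope.

(* e^{it} *)
Definition expi (t : R) : C := (cos t, sin t).

Definition torus_field (omega delta B theta tau : R) : R :=
  (cos theta + B) / (omega * (1 - delta * cos tau)).

Definition denom (omega delta : R) (z : C) : C :=
  (RtoC omega * (RtoC delta * (1 + z * z) - 2 * z))%C.

Definition riccati_field (omega delta B : R) (z Phi : C) : C :=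
  (- ((1 + 2 * RtoC B * Phi + Phi * Phi) / denom omega delta z))%C.

Definition Mat (m n : nat) : Type := @matrix C_Ring m n.

Definition entry {m n : nat} (M : Mat m n) (i j : nat) : C :=
  coeff_mat (zero : C_Ring) M i j.

(* [denom] has no zero on the unit circle when 0 < delta < 1, so the value
   given to a division by zero does not matter near that circle. *)
Definition lin_system (omega delta B : R) (z : C) : Mat 2 2 :=
  mk_matrix 2 2 (fun i j =>
    (match i, j with
     | O, O => 2 * RtoC B
     | O, _ => 1
     | _, O => - (1)
     | _, _ => 0
     end / denom omega delta z)%C).

(* dY/dz = A(z) Y holds at the point z, for the complex derivative. *)
Definition solves_at {n : nat} (A : C -> Mat n n) (Y : C -> Mat n 1) (z : C)
    : Prop :=
  forall i : nat, (i < n)%nat ->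
    is_derive (fun w : C => entry (Y w) i 0) z (entry (Mmult (A z) (Y z)) i 0).

(* Analytic continuation along gamma : [a, b] -> C of a germ of solution.
   Only the germ of [Y t] at gamma(t) is meaningful: it solves the system,
   and for s close to t the germ of [Y s] at gamma(s) is the one given by
   [Y t]. *)
Definition continuation {n : nat} (A : C -> Mat n n) (gamma : R -> C) (a b : R)
    (Y : R -> C -> Mat n 1) : Prop :=
  (forall t, a <= t <= b -> locally (gamma t) (solves_at A (Y t))) /\
  (forall t, a <= t <= b ->
     exists eta, 0 < eta /\
       forall s, a <= s <= b -> Rabs (s - t) < eta ->
         locally (gamma s) (fun z => Y s z = Y t z)).

(* M is the monodromy of dY/dz = A(z) Y along the loop gamma, in the basis of
   the space of germs of solutions at gamma(a) given by the values at
   gamma(a): every initial value can be continued along gamma, and the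
   continuation of a germ with value y has value M y when the loop closes. *)
Definition is_monodromy {n : nat} (A : C -> Mat n n) (gamma : R -> C) (a b : R)
    (M : Mat n n) : Prop :=
  gamma a = gamma b /\
  (forall y : Mat n 1,
     exists Y, continuation A gamma a b Y /\ Y a (gamma a) = y) /\
  (forall Y, continuation A gamma a b Y ->
     Y b (gamma b) = Mmult M (Y a (gamma a))).

Definition scalar_matrix (n : nat) (c : C) : Mat n n :=
  mk_matrix n n (fun i j => if Nat.eqb i j then c else RtoC 0).

(* With Phi = e^{i theta}, z = e^{i tau}, so that dPhi = i Phi dtheta and
   dz = i z dtau, the vector field on the torus becomes the Riccati field. *)
Lemma torus_riccati (omega delta B theta tau : R) :
  omega <> 0 -> 0 < delta < 1 ->
  (Ci * expi theta * RtoC (torus_field omega delta B theta tau) =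
   riccati_field omega delta B (expi tau) (expi theta) * (Ci * expi tau))%C.
Proof.
intros Ho Hd.
set (p := expi theta); set (z := expi tau).
assert (Hp : (1 + p * p = 2 * RtoC (cos theta) * p)%C).
{ unfold p, expi, Cmult, Cplus, RtoC; cbn.
  f_equal; [|ring].
  generalize (sin2_cos2 theta); unfold Rsqr; lra. }
assert (Hz : (1 + z * z = 2 * RtoC (cos tau) * z)%C).
{ unfold z, expi, Cmult, Cplus, RtoC; cbn.
  f_equal; [|ring].
  generalize (sin2_cos2 tau); unfold Rsqr; lra. }
assert (Hz0 : z <> RtoC 0).
{ unfold z, expi, RtoC; intros [= E1 E2].
  generalize (sin2_cos2 tau); unfold Rsqr; rewrite E1, E2; lra. }
assert (Hk : 1 - delta * cos tau <> 0).
{ generalize (COS_bound tau); nra. }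
assert (Hk' : (RtoC 1 - RtoC delta * RtoC (cos tau))%C <> RtoC 0).
{ rewrite <- RtoC_mult, <- RtoC_minus; intros E; apply Hk.
  now injection E. }
assert (Ho' : RtoC omega <> RtoC 0).
{ intros E; apply Ho; now injection E. }
assert (HD : denom omega delta z =
  ((- RtoC 2) * (RtoC omega * (1 - RtoC delta * RtoC (cos tau))) * z)%C).
{ unfold denom; rewrite Hz; ring. }
unfold riccati_field, torus_field; rewrite HD.
replace (1 + 2 * RtoC B * p + p * p)%C
  with (2 * (RtoC (cos theta) + RtoC B) * p)%C
  by (replace (1 + 2 * RtoC B * p + p * p)%C
        with (1 + p * p + 2 * RtoC B * p)%C by ring; rewrite Hp; ring).
rewrite RtoC_div, RtoC_plus, RtoC_mult, RtoC_minus, RtoC_mult by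
  (apply Rmult_integral_contrapositive_currified; assumption).
field.
repeat split; try assumption.
Qed.

(* If (u, v) solves the linear system then Phi = v / u solves the Riccati
   equation, as Phi' = (v' u - v u') / u^2. *)
Lemma riccati_linear (omega delta B : R) (z : C) (Y : Mat 2 1) :
  denom omega delta z <> RtoC 0 -> entry Y 0 0 <> RtoC 0 ->
  let D := Mmult (lin_system omega delta B z) Y in
  ((entry D 1 0 * entry Y 0 0 - entry Y 1 0 * entry D 0 0)
     / (entry Y 0 0 * entry Y 0 0) =
   riccati_field omega delta B z (entry Y 1 0 / entry Y 0 0))%C.
Proof.
intros Hz Hu D.
assert (H : forall i, (i < 2)%nat -> entry D i 0 =
  (entry (lin_system omega delta B z) i 0 * entry Y 0 0 +
   entry (lin_system omega delta B z) i 1 * entry Y 1 0)%C).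
{ intros i Hi; unfold D, Mmult; unfold entry at 1.
  rewrite coeff_mat_bij by (auto with arith).
  now cbn [Init.Nat.pred]; rewrite sum_Sn, sum_O. }
rewrite !H by auto with arith.
set (u := entry Y 0 0) in *; set (v := entry Y 1 0) in *.
unfold lin_system, entry, riccati_field.
rewrite !coeff_mat_bij by auto with arith; cbv beta iota.
set (d := denom _ _ _) in *.
field; split; assumption.
Qed.

(* Main.v *)
Require Import Defs.
From Stdlib Require Import Reals Lra Lia.
From Coquelicot Require Import Coquelicot.
Open Scope R_scope.

(** The system is [Y' = K / d(z) Y] with a constant matrix
    [K = [[2B, 1], [-1, 0]]] and the scalar denominator
    [d(z) = omega (delta (1 + z^2) - 2 z)], so its solutions are functions of
    [K] and split along the eigenvectors of [K]. The eigenvalues are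
    [l = B + r] and [l = B - r] with [r = sqrt (B^2 - 1)]; they are real and
    distinct as [B > 1], and their product is 1.

    The zeros of [d] are [b] and [1 / b] with [0 < b < 1], so that [1 / d] is a
    constant multiple of the logarithmic derivative of the Blaschke factor
    [g(z) = (z - b) / (1 - b z)] ([inv_denom]). For an eigenvalue [l] the
    equation [w' = l / d w] is then solved by the power [g^m] with the real
    exponent [m = - l / (2 omega s)], [s = sqrt (1 - delta^2)]. As [g] winds
    once around 0 along the unit circle, the continuation of [g^m] multiplies
    it by [exp (2 i PI m)]. The logarithm of [g] is written as an explicit
    family of germs ([branch]), in which only [log z] is multivalued; this
    gives the existence of the continuations. Any other continued solution of
    the scalar equation has a locally constant quotient by [g^m], so it is
    multiplied by the same number ([scalar_monodromy]).

    Hence the monodromy is the function of [K] with the values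
    [exp (2 i PI m1)] and [exp (2 i PI m2)] at the two eigenvalues
    ([is_monodromy_spectral]). It is scalar exactly when the two values agree
    ([spectral_scalar_iff]), that is when [m1 - m2 = - r / (omega s)] is an
    integer [n]. Squaring, [B^2 - 1 = omega^2 (1 - delta^2) n^2]; the sign lost
    by squaring is absorbed by the sign of [n]. *)

(** * Complex differentiation *)

Lemma is_derive_C_iff (f : C -> C) (z l : C) :
  is_derive f z l <->
  forall eps : R, 0 < eps -> exists d, 0 < d /\ forall w, Cmod (w - z) < d ->
    Cmod (f w - f z - (w - z) * l) <= eps * Cmod (w - z).
Proof.
split.
- intros [_ H] eps Heps.
  destruct (H z (fun P HP => HP) (mkposreal eps Heps)) as [d Hd].
  exists d; split; [apply cond_pos|].
  intros w Hw; exact (Hd w Hw).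
- intros H; split; [apply is_linear_scal_l|].
  intros x Hx eps.
  assert (Ex : z = x)
    by (apply (@is_filter_lim_locally_unique C_AbsRing
                 (AbsRing_NormedModule C_AbsRing)); exact Hx).
  rewrite <- Ex.
  destruct (H eps (cond_pos eps)) as [d [Hd0 Hd]].
  exists (mkposreal d Hd0).
  intros w Hw; exact (Hd w Hw).
Qed.

(** The product and chain rules need a map valued in the field itself, whose
    normed-module structure is not syntactically [C_NormedModule]; the two
    structures share their norm, and a derivative depends on nothing else. *)
Lemma is_derive_C_AbsRing (f : C -> C) (z l : C) :
  is_derive f z l <->
  @is_derive C_AbsRing (AbsRing_NormedModule C_AbsRing) f z l.
Proof.
split; intros [_ H]; (split; [apply is_linear_scal_l | exact H]).
Qed.

Lemma is_derive_C_mult (f g : C -> C) (z df dg : C) :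
  is_derive f z df -> is_derive g z dg ->
  is_derive (fun w => f w * g w)%C z (df * g z + f z * dg)%C.
Proof.
intros Hf Hg; apply is_derive_C_AbsRing.
apply (@is_derive_mult C_AbsRing f g); try now apply is_derive_C_AbsRing.
exact Cmult_comm.
Qed.

Lemma is_derive_C_comp (f g : C -> C) (z df dg : C) :
  is_derive f (g z) df -> is_derive g z dg ->
  is_derive (fun w => f (g w)) z (df * dg)%C.
Proof.
intros Hf Hg; rewrite Cmult_comm.
apply (@is_derive_comp C_AbsRing C_NormedModule f g z df dg Hf).
now apply is_derive_C_AbsRing.
Qed.

Lemma is_derive_C_eq (f : C -> C) (z l l' : C) :
  is_derive f z l -> l = l' -> is_derive f z l'.
Proof. now intros H <-. Qed.

Lemma is_derive_C_id (z : C) : is_derive (fun w : C => w) z (RtoC 1).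
Proof. apply is_derive_C_AbsRing; apply (@is_derive_id C_AbsRing). Qed.

Lemma is_derive_C_const (c z : C) : is_derive (fun _ : C => c) z (RtoC 0).
Proof. apply (@is_derive_const C_AbsRing C_NormedModule). Qed.

Lemma is_derive_C_plus (f g : C -> C) (z df dg : C) :
  is_derive f z df -> is_derive g z dg ->
  is_derive (fun w => f w + g w)%C z (df + dg)%C.
Proof. apply (@is_derive_plus C_AbsRing C_NormedModule). Qed.

Lemma is_derive_C_minus (f g : C -> C) (z df dg : C) :
  is_derive f z df -> is_derive g z dg ->
  is_derive (fun w => f w - g w)%C z (df - dg)%C.
Proof. apply (@is_derive_minus C_AbsRing C_NormedModule). Qed.

Lemma is_derive_C_scal (c : C) (f : C -> C) (z df : C) :
  is_derive f z df -> is_derive (fun w => c * f w)%C z (c * df)%C.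
Proof.
intros Hf.
apply (is_derive_C_eq _ _ (0 * f z + c * df)%C); [|ring].
exact (is_derive_C_mult _ _ _ _ _ (is_derive_C_const c z) Hf).
Qed.

Lemma is_derive_C_inv (z : C) :
  z <> 0 -> is_derive Cinv z (- / (z * z))%C.
Proof.
intros Hz; apply is_derive_C_iff; intros eps Heps.
assert (Hr : 0 < Cmod z) by now apply Cmod_gt_0.
set (r := Cmod z) in *.
exists (Rmin (r / 2) (eps * r ^ 3 / 2)); split.
{ apply Rmin_glb_lt; [lra|].
  assert (0 < eps * r ^ 3) by (apply Rmult_lt_0_compat; [lra|now apply pow_lt]).
  lra. }
intros w Hw.
assert (H1 : Cmod (w - z) < r / 2) by (eapply Rlt_le_trans; [apply Hw|apply Rmin_l]).
assert (H2 : Cmod (w - z) < eps * r ^ 3 / 2)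
  by (eapply Rlt_le_trans; [apply Hw|apply Rmin_r]).
assert (Hwr : r / 2 <= Cmod w).
{ assert (r <= Cmod w + Cmod (w - z)).
  { unfold r; replace z with (w + - (w - z))%C at 1 by ring.
    rewrite <- (Cmod_opp (w - z)); apply Cmod_triangle. }
  lra. }
assert (Hw0 : w <> 0) by (apply Cmod_gt_0; lra).
replace (/ w - / z - (w - z) * - / (z * z))%C
  with ((w - z) * ((w - z) / (w * (z * z))))%C by (field; split; assumption).
rewrite Cmod_mult, Rmult_comm.
apply Rmult_le_compat_r; [apply Cmod_ge_0|].
rewrite Cmod_div by (repeat apply Cmult_neq_0; assumption).
rewrite !Cmod_mult; fold r.
apply Rle_div_l; [repeat apply Rmult_lt_0_compat; lra|].
apply Rle_trans with (eps * (r / 2 * (r * r))); [nra|].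
apply Rmult_le_compat_l; [lra|].
apply Rmult_le_compat_r; [nra|lra].
Qed.

(** The real differential of [(u, v)] is the matrix [[a, -b], [b, a]], which
    is multiplication by the complex number [a + ib]. *)
Lemma is_derive_cauchy_riemann (u v : R -> R -> R) (z : C) (a b : R) :
  differentiable_pt_lim u (fst z) (snd z) a (- b) ->
  differentiable_pt_lim v (fst z) (snd z) b a ->
  is_derive (fun w : C => (u (fst w) (snd w), v (fst w) (snd w)) : C) z
    ((a, b) : C).
Proof.
intros Hu Hv; apply is_derive_C_iff; intros eps Heps.
assert (He2 : 0 < eps / 2) by lra.
destruct (Hu (mkposreal _ He2)) as [d1 H1].
destruct (Hv (mkposreal _ He2)) as [d2 H2].
exists (Rmin d1 d2); split; [apply Rmin_glb_lt; apply cond_pos|].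
intros w Hw.
set (x := fst z) in *; set (y := snd z) in *.
assert (Hmax := Rmax_Cmod (w - z)%C).
change (Rmax (Rabs (fst w - x)) (Rabs (snd w - y)) <= Cmod (w - z)) in Hmax.
assert (Hx := Rmax_l (Rabs (fst w - x)) (Rabs (snd w - y))).
assert (Hy := Rmax_r (Rabs (fst w - x)) (Rabs (snd w - y))).
assert (M1 := Rmin_l d1 d2). assert (M2 := Rmin_r d1 d2).
specialize (H1 (fst w) (snd w)); specialize (H2 (fst w) (snd w)).
cbn [pos] in H1, H2.
assert (K1 := H1 ltac:(lra) ltac:(lra)).
assert (K2 := H2 ltac:(lra) ltac:(lra)).
clear H1 H2.
match goal with |- Cmod ?d <= _ =>
  replace d with
   (RtoC (u (fst w) (snd w) - u x y - (a * (fst w - x) + - b * (snd w - y)))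
    + Ci * RtoC (v (fst w) (snd w) - v x y - (b * (fst w - x) + a * (snd w - y))))%C
end.
2: { unfold x, y, Cminus, Cplus, Copp, Cmult, RtoC, Ci; cbn; f_equal; ring. }
eapply Rle_trans; [apply Cmod_triangle|].
assert (HCi : Cmod Ci = 1).
{ unfold Cmod, Ci; cbn. replace (0 * (0 * 1) + 1 * (1 * 1)) with 1 by ring. apply sqrt_1. }
rewrite Cmod_mult, HCi, !Cmod_R.
nra.
Qed.

Lemma differentiable_pt_lim_partial (f dfx : R -> R -> R) (x y dfy : R) :
  locally ((x, y) : R * R) (fun p : R * R =>
    is_derive (fun t : R => f t (snd p)) (fst p) (dfx (fst p) (snd p))) ->
  is_derive (fun t : R => f x t) y dfy ->
  continuous (fun p : R * R => dfx (fst p) (snd p)) (x, y) ->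
  differentiable_pt_lim f x y (dfx x y) dfy.
Proof.
intros H1 H2 H3; apply filterdiff_differentiable_pt_lim.
exact (is_derive_filterdiff f x y dfx dfy H1 H2 H3).
Qed.

(** * Exponential and principal logarithm *)

Definition cexp (z : C) : C :=
  (exp (fst z) * cos (snd z), exp (fst z) * sin (snd z)).

(** On the right half-plane this is the principal branch, as [atan (y / x)] is
    the argument there. *)
Definition clog (z : C) : C :=
  (ln (fst z ^ 2 + snd z ^ 2) / 2, atan (snd z / fst z)).

Lemma is_derive_cexp (z : C) : is_derive cexp z (cexp z).
Proof.
apply (is_derive_cauchy_riemann (fun x y => exp x * cos y)
         (fun x y => exp x * sin y)).
- apply (differentiable_pt_lim_partial (fun x y => exp x * cos y)
           (fun x y => exp x * cos y)).
  + apply filter_forall; intros [x y]; cbn. auto_derive; [easy|ring].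
  + auto_derive; [easy|ring].
  + apply (continuous_mult (fun p : R * R => exp (fst p)) (fun p => cos (snd p))).
    * apply (continuous_comp fst exp); [apply continuous_fst|apply continuous_exp].
    * apply (continuous_comp snd cos); [apply continuous_snd|apply continuous_cos].
- apply (differentiable_pt_lim_partial (fun x y => exp x * sin y)
           (fun x y => exp x * sin y)).
  + apply filter_forall; intros [x y]; cbn. auto_derive; [easy|ring].
  + auto_derive; [easy|ring].
  + apply (continuous_mult (fun p : R * R => exp (fst p)) (fun p => sin (snd p))).
    * apply (continuous_comp fst exp); [apply continuous_fst|apply continuous_exp].
    * apply (continuous_comp snd sin); [apply continuous_snd|apply continuous_sin].
Qed.

Lemma locally_Re_gt_0 (z : C) : 0 < fst z -> locally z (fun w : C => 0 < fst w).
Proof.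
destruct z as [x y]; intros Hx.
now apply (continuous_fst x y (fun t : R => 0 < t)), open_gt.
Qed.

Lemma continuous_div_normsq (f : R * R -> R) (p : R * R) :
  0 < fst p -> continuous f p ->
  continuous (fun q : R * R => f q / (fst q ^ 2 + snd q ^ 2)) p.
Proof.
intros Hp Hf.
apply (continuous_mult f); [exact Hf|].
apply continuous_comp; [|apply continuous_Rinv; cbn; nra].
apply (continuous_plus (fun q : R * R => fst q ^ 2) (fun q => snd q ^ 2)); cbn.
- apply (continuous_mult (fun q : R * R => fst q) (fun q => fst q * 1)); [apply continuous_fst|].
  apply (continuous_mult (fun q : R * R => fst q) (fun q => 1)); [apply continuous_fst|apply continuous_const].
- apply (continuous_mult (fun q : R * R => snd q) (fun q => snd q * 1)); [apply continuous_snd|].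
  apply (continuous_mult (fun q : R * R => snd q) (fun q => 1)); [apply continuous_snd|apply continuous_const].
Qed.

Lemma is_derive_clog (z : C) : 0 < fst z -> is_derive clog z (/ z)%C.
Proof.
intros Hz.
replace (/ z)%C with ((fst z / (fst z ^ 2 + snd z ^ 2), - snd z / (fst z ^ 2 + snd z ^ 2)) : C)
  by reflexivity.
apply (is_derive_cauchy_riemann (fun x y => ln (x ^ 2 + y ^ 2) / 2)
         (fun x y => atan (y / x))).
- apply (differentiable_pt_lim_partial (fun x y => ln (x ^ 2 + y ^ 2) / 2)
           (fun x y => x / (x ^ 2 + y ^ 2))).
  + generalize (locally_Re_gt_0 z Hz); destruct z as [z1 z2]; apply filter_imp; intros [x y]; cbn; intros Hx.
    auto_derive; [nra|field; nra].
  + auto_derive; [nra|field; nra].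
  + apply continuous_div_normsq; [exact Hz|apply continuous_fst].
- apply (differentiable_pt_lim_partial (fun x y => atan (y / x))
           (fun x y => - y / (x ^ 2 + y ^ 2))).
  + generalize (locally_Re_gt_0 z Hz); destruct z as [z1 z2]; apply filter_imp; intros [x y]; cbn; intros Hx.
    auto_derive; [lra|unfold Rsqr; field; split; nra].
  + auto_derive; [lra|unfold Rsqr; field; split; nra].
  + apply (continuous_div_normsq (fun q => - snd q)); [exact Hz|].
    apply (continuous_opp (fun q : R * R => snd q)); apply continuous_snd.
Qed.

Lemma cexp_0 : cexp 0 = 1.
Proof. unfold cexp, RtoC; cbn; rewrite exp_0, cos_0, sin_0; f_equal; ring. Qed.

Lemma expi_plus (s t : R) : expi (s + t) = (expi s * expi t)%C.
Proof.
unfold expi, Cmult; cbn; rewrite cos_plus, sin_plus; f_equal; ring.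
Qed.

Lemma expi_0 : expi 0 = 1.
Proof. unfold expi; now rewrite cos_0, sin_0. Qed.

Lemma expi_2PI : expi (2 * PI) = 1.
Proof. unfold expi; now rewrite cos_2PI, sin_2PI. Qed.

Lemma cexp_imag (t : R) : cexp (0, t) = expi t.
Proof. unfold cexp, expi; cbn; rewrite exp_0; f_equal; ring. Qed.

Lemma Cmod_expi (t : R) : Cmod (expi t) = 1.
Proof.
unfold Cmod, expi; cbn [fst snd].
rewrite <- sqrt_1; f_equal; generalize (sin2_cos2 t); unfold Rsqr; lra.
Qed.

Lemma expi_eq_iff (x y : R) :
  expi x = expi y <-> exists n : Z, x - y = 2 * PI * IZR n.
Proof.
split.
- intros [= Ec Es].
  assert (H : cos (x - y) = 1).
  { rewrite cos_minus, Ec, Es; generalize (sin2_cos2 y); unfold Rsqr; lra. }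
  replace (x - y) with (2 * ((x - y) / 2)) in H by field.
  rewrite cos_2a_sin in H.
  destruct (sin_eq_0_0 ((x - y) / 2)) as [n Hn]; [nra|].
  exists n; lra.
- intros [n Hn].
  replace x with (y + (x - y)) by ring.
  rewrite expi_plus, Hn.
  assert (Hs : sin (PI * IZR n) = 0)
    by (apply sin_eq_0_1; exists n; ring).
  replace (expi (2 * PI * IZR n)) with (RtoC 1); [ring|].
  unfold expi; rewrite Rmult_assoc, cos_2a_sin, sin_2a, Hs.
  unfold RtoC; f_equal; ring.
Qed.

Lemma clog_1 : clog 1 = 0.
Proof.
unfold clog, RtoC; cbn.
replace (1 * (1 * 1) + 0 * (0 * 1)) with 1 by ring.
rewrite ln_1; replace (0 / 1) with 0 by field; rewrite atan_0; f_equal; field.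
Qed.

(** The principal logarithm is additive along a rotation that does not leave
    the right half-plane: the argument [p + h] stays in [(-PI, PI)] as
    [|h| < PI / 2], and its cosine is positive, so it lies in
    [(-PI/2, PI/2)], where [atan] inverts [tan]. *)
Lemma clog_mult_expi (z : C) (h : R) :
  0 < fst z -> 0 < fst (z * expi h)%C -> Rabs h < PI / 2 ->
  clog (z * expi h) = (clog z + (0, h))%C.
Proof.
destruct z as [x y]; cbn; intros Hx Hre Hh.
unfold clog, Cplus; cbn [fst snd Cmult expi].
apply Rabs_def2 in Hh.
f_equal.
- rewrite Rplus_0_r; do 2 f_equal.
  generalize (sin2_cos2 h); unfold Rsqr; intros E.
  transitivity ((x ^ 2 + y ^ 2) * (sin h * sin h + cos h * cos h)); [ring|].
  rewrite E; ring.
- set (p := atan (y / x)).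
  assert (Hp := atan_bound (y / x)); fold p in Hp.
  assert (HPI := PI_RGT_0).
  assert (Hcp : 0 < cos p) by (apply cos_gt_0; lra).
  assert (Hsp : sin p * x = cos p * y).
  { assert (E : tan p = y / x) by apply tan_atan.
    unfold tan in E; apply Rmult_eq_reg_r with (/ cos p * / x).
    - field_simplify; [|lra|lra]; rewrite <- E; field; lra.
    - apply Rmult_integral_contrapositive_currified; apply Rinv_neq_0_compat; lra. }
  assert (E1 : cos (p + h) * x = cos p * (x * cos h - y * sin h))
    by (rewrite cos_plus;
        transitivity (cos p * x * cos h - sin p * x * sin h);
        [ring | rewrite Hsp; ring]).
  assert (E2 : sin (p + h) * x = cos p * (x * sin h + y * cos h))
    by (rewrite sin_plus;
        transitivity (sin p * x * cos h + cos p * x * sin h);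
        [ring | rewrite Hsp; ring]).
  assert (Hc : 0 < cos (p + h)).
  { apply Rmult_lt_reg_r with x; [exact Hx|]. rewrite E1, Rmult_0_l.
    now apply Rmult_lt_0_compat. }
  assert (Hb : - (PI / 2) < p + h < PI / 2).
  { split; apply Rnot_le_lt; intros Hn.
    - rewrite <- cos_neg in Hc.
      assert (cos (- (p + h)) <= 0) by (apply cos_le_0; lra). lra.
    - assert (cos (p + h) <= 0) by (apply cos_le_0; lra). lra. }
  rewrite <- (atan_tan (p + h)) by exact Hb.
  f_equal; unfold tan.
  (* Compare the tangents, using [E1] and [E2] for [cos p] times the rotated
     point. *)
  apply Rmult_eq_reg_r with (cos (p + h) * x * (x * cos h - y * sin h));
    [|repeat apply Rmult_integral_contrapositive_currified; lra].
  transitivity ((x * sin h + y * cos h) * (cos (p + h) * x)); [field; lra|].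
  transitivity ((sin (p + h) * x) * (x * cos h - y * sin h)); [|field; lra].
  rewrite E1, E2; ring.
Qed.

(** * The logarithm of a Blaschke factor, continued along the unit circle *)

(** The germ at [expi t] of the logarithm of [(z - b) / (1 - b z)], continued
    from [z = 1]. Write [z - b = z (1 - b / z)]: for [b < |z| < 1 / b] the
    numbers [1 - b / z] and [1 - b z] have positive real part, so that only
    the factor [z] turns around the origin; near [expi t] its logarithm is
    [i t + clog (z / expi t)]. *)
Definition branch (b t : R) (z : C) : C :=
  ((0, t) + clog (z * expi (- t))
   + (clog (1 - RtoC b * / z) - clog (1 - RtoC b * z)))%C.

(** The logarithmic derivative of [(z - b) / (1 - b z)]. *)
Definition logder (b : R) (z : C) : C :=
  ((1 - b * b) / ((z - b) * (1 - b * z)))%C.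

Lemma Re_1_minus_gt_0 (w : C) : Cmod w < 1 -> 0 < fst (1 - w)%C.
Proof.
intros Hw; assert (H := re_le_Cmod w); assert (H' := Rle_abs (Re w)).
cbn; unfold Re in *; lra.
Qed.

Lemma Re_gt_0_neq_0 (z : C) : 0 < fst z -> z <> 0.
Proof. intros H E; rewrite E in H; cbn in H; lra. Qed.

Lemma Re_mult_expi_gt_0 (t : R) (z : C) :
  Cmod (z - expi t) < 1 -> 0 < fst (z * expi (- t))%C.
Proof.
intros H.
replace (z * expi (- t))%C with (1 - (expi t - z) * expi (- t))%C.
- apply Re_1_minus_gt_0; rewrite Cmod_mult, Cmod_expi, Rmult_1_r.
  rewrite <- Cmod_opp; replace (- (expi t - z))%C with (z - expi t)%C by ring.
  exact H.
- assert (E : (expi t * expi (- t))%C = 1)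
    by (rewrite <- expi_plus, Rplus_opp_r; apply expi_0).
  transitivity (1 - expi t * expi (- t) + z * expi (- t))%C; [ring|].
  rewrite E; ring.
Qed.

(** The radius [1 - b] does not depend on [t]: it keeps [b < |z| < 2 - b], and
    [b (2 - b) < 1], so that the three arguments of [clog] stay in the right
    half-plane. *)
Lemma is_derive_branch (b t : R) (z : C) :
  0 < b < 1 -> Cmod (z - expi t) < 1 - b ->
  (z - b)%C <> 0 /\ (1 - b * z)%C <> 0 /\
  is_derive (branch b t) z (logder b z).
Proof.
intros Hb Hz.
assert (R1 : 0 < fst (z * expi (- t))%C) by (apply Re_mult_expi_gt_0; lra).
assert (Hlo : b < Cmod z).
{ assert (H : Cmod (expi t) <= Cmod z + Cmod (z - expi t)).
  { replace (expi t) with (z + - (z - expi t))%C at 1 by ring.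
    rewrite <- (Cmod_opp (z - expi t)); apply Cmod_triangle. }
  rewrite Cmod_expi in H; lra. }
assert (Hhi : Cmod z < 2 - b).
{ assert (H : Cmod z <= Cmod (expi t) + Cmod (z - expi t)).
  { replace z with (expi t + (z - expi t))%C at 1 by ring; apply Cmod_triangle. }
  rewrite Cmod_expi in H; lra. }
assert (Hz0 : z <> 0) by (apply Cmod_gt_0; lra).
assert (Hab : Cmod b = b) by (rewrite Cmod_R; apply Rabs_pos_eq; lra).
assert (R2 : 0 < fst (1 - b * / z)%C).
{ apply Re_1_minus_gt_0; rewrite Cmod_mult, Cmod_inv, Hab by exact Hz0.
  apply Rlt_div_l; lra. }
assert (R3 : 0 < fst (1 - b * z)%C).
{ apply Re_1_minus_gt_0; rewrite Cmod_mult, Hab; nra. }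
assert (N1 := Re_gt_0_neq_0 _ R1).
assert (N2 := Re_gt_0_neq_0 _ R2).
assert (N3 := Re_gt_0_neq_0 _ R3).
assert (N4 : (z - b)%C <> 0).
{ intros E; apply N2.
  replace (1 - b * / z)%C with ((z - b) * / z)%C by (field; exact Hz0).
  rewrite E; ring. }
split; [exact N4|split; [exact N3|]].
assert (Ht : expi (- t) <> 0).
{ intros E; apply N1; rewrite E; ring. }
eapply is_derive_C_eq.
- apply is_derive_C_plus; [apply is_derive_C_plus|apply is_derive_C_minus].
  + apply is_derive_C_const.
  + apply (is_derive_C_comp clog (fun w => w * expi (- t))%C).
    * now apply is_derive_clog.
    * apply is_derive_C_mult; [apply is_derive_C_id|apply is_derive_C_const].
  + apply (is_derive_C_comp clog (fun w => 1 - b * / w)%C).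
    * now apply is_derive_clog.
    * apply is_derive_C_minus; [apply is_derive_C_const|].
      apply is_derive_C_scal; now apply is_derive_C_inv.
  + apply (is_derive_C_comp clog (fun w => 1 - b * w)%C).
    * now apply is_derive_clog.
    * apply is_derive_C_minus; [apply is_derive_C_const|].
      apply is_derive_C_scal, is_derive_C_id.
- cbv beta; unfold logder; field; repeat split; assumption.
Qed.

Lemma branch_shift (b s t : R) (z : C) :
  Rabs (s - t) < PI / 2 ->
  0 < fst (z * expi (- s))%C -> 0 < fst (z * expi (- t))%C ->
  branch b s z = branch b t z.
Proof.
intros Hst Hs Ht; unfold branch; f_equal.
assert (E : (z * expi (- t))%C = (z * expi (- s) * expi (s - t))%C).
{ rewrite <- Cmult_assoc, <- expi_plus; do 2 f_equal; ring. }
rewrite E, (clog_mult_expi (z * expi (- s)) (s - t)) by (rewrite <- ?E; assumption).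
transitivity ((0, s) + clog (z * expi (- s)))%C; [reflexivity|].
rewrite (Cplus_comm _ (0, s - t)), Cplus_assoc; f_equal.
unfold Cplus; cbn; f_equal; ring.
Qed.

Lemma is_derive_C_locally (f : C -> C) (z l : C) (P : C -> Prop) :
  is_derive f z l -> locally (f z) P -> locally z (fun w => P (f w)).
Proof.
intros Hf HP; apply locally_C.
apply (ex_derive_continuous f z); [now exists l|exact HP].
Qed.

(** The family [branch b t] is a continuation along the unit circle: the germs
    of two members at nearby points agree. *)
Lemma branch_near (b s t : R) :
  Rabs (s - t) < PI / 2 ->
  locally (expi s) (fun z => branch b s z = branch b t z).
Proof.
intros H.
assert (Hloc : forall r, Rabs (s - r) < PI / 2 ->
  locally (expi s) (fun z => 0 < fst (z * expi (- r))%C)).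
{ intros r Hr; apply Rabs_def2 in Hr.
  apply (is_derive_C_locally (fun z => z * expi (- r))%C (expi s)
           (1 * expi (- r) + expi s * 0)%C (fun w : C => 0 < fst w)).
  - apply is_derive_C_mult; [apply is_derive_C_id|apply is_derive_C_const].
  - apply locally_Re_gt_0; rewrite <- expi_plus.
    apply cos_gt_0; lra. }
assert (H0 : Rabs (s - s) < PI / 2).
{ rewrite Rminus_diag, Rabs_R0; generalize PI_RGT_0; lra. }
generalize (filter_and _ _ (Hloc s H0) (Hloc t H)).
apply filter_imp; intros z [Hs Ht]; now apply branch_shift.
Qed.

Lemma continuous_expi (t : R) : continuous expi t.
Proof.
apply (continuous_comp_2 cos sin (fun x y => (x, y) : C)).
apply continuous_cos. apply continuous_sin.
apply (continuous_ext (fun p => p)). now intros []. apply continuous_id.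
Qed.

Lemma branch_start (b : R) : branch b 0 1 = 0.
Proof.
unfold branch.
rewrite Ropp_0, expi_0.
replace (RtoC 1 * RtoC 1)%C with (RtoC 1) by ring.
rewrite clog_1; replace (/ 1)%C with (RtoC 1) by (field; intros [=]; lra).
change ((0,0) : C) with (RtoC 0); ring.
Qed.

(** For [0 < b < 1] this is the argument principle: [b] is the only zero or pole
    of the Blaschke factor inside the circle. *)
Lemma branch_end (b : R) : branch b (2 * PI) 1 = (0, 2 * PI) :> C.
Proof.
unfold branch.
replace (expi (- (2 * PI))) with (RtoC 1).
2: { unfold expi; rewrite cos_neg, sin_neg, cos_2PI, sin_2PI, Ropp_0; reflexivity. }
replace (RtoC 1 * RtoC 1)%C with (RtoC 1) by ring.
rewrite clog_1; replace (/ 1)%C with (RtoC 1) by (field; intros [=]; lra).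
ring.
Qed.

(** * Scalar equations along the unit circle *)

(** Composing with the projection onto [[a, b]] turns the one-sided hypotheses
    at the end points into a zero derivative. *)
Lemma eq_of_locally_constant (f : R -> C) (a b : R) :
  a < b ->
  (forall t, a <= t <= b -> exists eta, 0 < eta /\
     forall s, a <= s <= b -> Rabs (s - t) < eta -> f s = f t) ->
  f a = f b.
Proof.
intros Hab H.
set (clamp := fun t => Rmax a (Rmin b t)).
assert (Hclamp : forall t, a <= t <= b -> clamp t = t).
{ intros t Ht; unfold clamp; rewrite Rmin_right, Rmax_right; lra. }
rewrite <- (Hclamp a), <- (Hclamp b) by lra.
apply (@eq_is_derive C_R_NormedModule (fun t => f (clamp t)) a b); [|exact Hab].
intros t Ht; destruct (H t Ht) as [eta [Heta Heq]].
apply (@is_derive_ext_loc R_AbsRing C_R_NormedModule (fun _ => f t));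
  [|apply (@is_derive_const R_AbsRing C_R_NormedModule)].
exists (mkposreal eta Heta); intros s Hs.
change (Rabs (s - t) < eta) in Hs.
symmetry; apply Heq.
- unfold clamp; split; [apply Rmax_l|apply Rmax_lub; [lra|apply Rmin_l]].
- revert Hs; unfold clamp, Rmax, Rmin, Rabs.
  repeat destruct Rle_dec; repeat destruct Rcase_abs; lra.
Qed.

Lemma norm_C_R (z : C) : @norm R_AbsRing C_R_NormedModule z = Cmod z.
Proof.
change (sqrt (Rabs (fst z) ^ 2 + Rabs (snd z) ^ 2) = Cmod z).
now rewrite !pow2_abs.
Qed.

(** A small disc is convex: along the segment from [z] to [w] the function has
    zero real derivative. *)
Lemma locally_constant_of_derive_0 (f : C -> C) (z : C) :
  locally z (fun w => is_derive f w (RtoC 0)) -> locally z (fun w => f w = f z).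
Proof.
intros H; apply locally_C in H; apply locally_C.
destruct H as [d Hd]; exists d; intros w Hw.
change (Cmod (w - z) < d) in Hw.
set (h := (w - z)%C) in *.
pose (F := fun t : R => f (z + t * h)%C).
assert (E0 : F 0 = f z) by (unfold F; f_equal; ring).
assert (E1 : F 1 = f w) by (unfold F; f_equal; unfold h; ring).
rewrite <- E0, <- E1; symmetry.
apply (@eq_is_derive C_R_NormedModule F 0 1); [|lra].
intros t Ht; split; [apply @is_linear_scal_l|].
intros x Hx eps.
assert (Ex : t = x)
  by (apply (@is_filter_lim_locally_unique R_AbsRing
               (AbsRing_NormedModule R_AbsRing)); exact Hx).
rewrite <- Ex; clear x Hx Ex.
assert (Hh : 0 <= Cmod h) by apply Cmod_ge_0.
assert (Hdt : is_derive f (z + t * h)%C (RtoC 0)).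
{ apply Hd; change (Cmod (z + t * h - z)%C < d).
  replace (z + t * h - z)%C with (RtoC t * h)%C by ring.
  rewrite Cmod_mult, Cmod_R, Rabs_pos_eq by lra; nra. }
assert (He : 0 < eps / (Cmod h + 1)).
{ apply Rdiv_lt_0_compat; [apply cond_pos|lra]. }
destruct (proj1 (is_derive_C_iff _ _ _) Hdt _ He) as [r [Hr Hfr]].
assert (Hr' : 0 < r / (Cmod h + 1)) by (apply Rdiv_lt_0_compat; lra).
exists (mkposreal _ Hr'); intros s Hs.
change (Rabs (s - t) < r / (Cmod h + 1)) in Hs.
assert (Hmod : Cmod (z + s * h - (z + t * h)) = Rabs (s - t) * Cmod h).
{ replace (z + s * h - (z + t * h))%C with (RtoC (s - t) * h)%C
    by (rewrite RtoC_minus; ring).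
  now rewrite Cmod_mult, Cmod_R. }
assert (Habs := Rabs_pos (s - t)).
assert (Hs2 : Rabs (s - t) * (Cmod h + 1) < r) by (apply Rlt_div_r; lra).
specialize (Hfr (z + s * h)%C); rewrite Hmod in Hfr.
specialize (Hfr ltac:(nra)).
apply Rle_trans with (eps / (Cmod h + 1) * (Rabs (s - t) * Cmod h)).
- refine (Rle_trans _ _ _ (Req_le _ _ _) Hfr).
  rewrite (@scal_zero_r R_AbsRing C_R_NormedModule), norm_C_R.
  change (Cmod (F s - F t - 0) =
          Cmod (F s - F t - (z + s * h - (z + t * h)) * 0)).
  f_equal; ring.
- change (eps / (Cmod h + 1) * (Rabs (s - t) * Cmod h) <= eps * Rabs (s - t)).
  assert (He2 : eps / (Cmod h + 1) * (Cmod h + 1) = eps) by (field; lra).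
  rewrite <- He2 at 2.
  nra.
Qed.

(** The germ at [expi t] of the [m]-th power of [(z - b) / (1 - b z)], continued
    from the value 1 at [z = 1]. *)
Definition power (b m t : R) (z : C) : C := cexp (m * branch b t z).

Lemma locally_expi (P : C -> Prop) (t r : R) :
  0 < r -> (forall z, Cmod (z - expi t) < r -> P z) -> locally (expi t) P.
Proof.
intros Hr H; apply locally_C; exists (mkposreal r Hr); exact H.
Qed.

Lemma is_derive_power (b m t : R) :
  0 < b < 1 ->
  locally (expi t) (fun z =>
    is_derive (power b m t) z (m * logder b z * power b m t z)%C).
Proof.
intros Hb; apply (locally_expi _ _ (1 - b)); [lra|]; intros z Hz.
destruct (is_derive_branch b t z Hb Hz) as [_ [_ H]].
eapply is_derive_C_eq.
- apply (is_derive_C_comp cexp (fun w => m * branch b t w)%C).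
  + apply is_derive_cexp.
  + apply is_derive_C_scal; exact H.
- unfold power; ring.
Qed.

Lemma power_near (b m s t : R) :
  Rabs (s - t) < PI / 2 ->
  locally (expi s) (fun z => power b m s z = power b m t z).
Proof.
intros H; generalize (branch_near b s t H); apply filter_imp.
intros z E; unfold power; now rewrite E.
Qed.

(** The quotient of a continued solution by the continued power of the Blaschke
    factor has zero derivative near each point of the circle and does not
    change with the germ, so it takes the same value at both ends; one turn
    thus multiplies the solution as it multiplies the power. *)
Lemma scalar_monodromy (b m : R) (W : R -> C -> C) :
  0 < b < 1 ->
  (forall t, 0 <= t <= 2 * PI -> locally (expi t) (fun z =>
     is_derive (W t) z (m * logder b z * W t z)%C)) ->
  (forall t, 0 <= t <= 2 * PI -> exists eta, 0 < eta /\
     forall s, 0 <= s <= 2 * PI -> Rabs (s - t) < eta ->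
       locally (expi s) (fun z => W s z = W t z)) ->
  W (2 * PI) (expi (2 * PI)) = (expi (m * (2 * PI))%R * W 0%R (expi 0%R))%C.
Proof.
intros Hb Hder Hcont.
assert (HPI := PI_RGT_0).
assert (Hq : (power b (- m)%R 0%R (expi 0%R) * W 0%R (expi 0%R) =
  power b (- m)%R (2 * PI)%R (expi (2 * PI)%R) * W (2 * PI)%R (expi (2 * PI)%R))%C).
{ apply (eq_of_locally_constant
    (fun t => power b (- m)%R t (expi t) * W t (expi t))%C); [lra|].
  intros t Ht.
  assert (Hc : locally (expi t) (fun z =>
    (power b (- m)%R t z * W t z = power b (- m)%R t (expi t) * W t (expi t))%C)).
  { apply (locally_constant_of_derive_0
             (fun z => power b (- m)%R t z * W t z)%C).
    generalize (filter_and _ _ (is_derive_power b (- m)%R t Hb) (Hder t Ht)).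
    apply filter_imp; intros z [H1 H2].
    eapply is_derive_C_eq; [apply is_derive_C_mult; [exact H1|exact H2]|].
    rewrite RtoC_opp; ring. }
  destruct (continuous_expi t _ Hc) as [e1 He1].
  destruct (Hcont t Ht) as [e2 [He2 HW]].
  exists (Rmin (Rmin e1 e2) (PI / 2)); split.
  { repeat apply Rmin_glb_lt; [apply cond_pos|exact He2|lra]. }
  intros s Hs Hst.
  assert (L1 := Rmin_l (Rmin e1 e2) (PI / 2)).
  assert (L2 := Rmin_r (Rmin e1 e2) (PI / 2)).
  assert (L3 := Rmin_l e1 e2). assert (L4 := Rmin_r e1 e2).
  rewrite (locally_singleton _ _ (power_near b (- m)%R s t ltac:(lra))).
  rewrite (locally_singleton _ _ (HW s Hs ltac:(lra))).
  apply He1; change (Rabs (s - t) < e1); lra. }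
revert Hq; rewrite expi_0, expi_2PI; unfold power.
rewrite branch_start, branch_end.
replace (RtoC (- m) * RtoC 0)%C with (RtoC 0) by ring.
replace (RtoC (- m) * (0%R, (2 * PI)%R))%C with ((0, - (m * (2 * PI))) : C)
  by (unfold Cmult, RtoC; cbn; f_equal; ring).
rewrite cexp_0, cexp_imag, Cmult_1_l; intros ->.
rewrite Cmult_assoc, <- expi_plus, Rplus_opp_r, expi_0; ring.
Qed.

(** * The linear system in Blaschke form *)

Lemma entry_mk_matrix (m n : nat) (f : nat -> nat -> C) (i j : nat) :
  (i < m)%nat -> (j < n)%nat -> entry (mk_matrix m n f : Mat m n) i j = f i j.
Proof. exact (coeff_mat_bij _ f i j). Qed.

Lemma entry_ext (m n : nat) (M N : Mat m n) :
  (forall i j, (i < m)%nat -> (j < n)%nat -> entry M i j = entry N i j) ->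
  M = N.
Proof. intros H; now apply (coeff_mat_ext_aux (zero : C_Ring) zero). Qed.

Lemma entry_Mmult_2 (n : nat) (A : Mat 2 2) (Y : Mat 2 n) (i j : nat) :
  (i < 2)%nat -> (j < n)%nat ->
  entry (Mmult A Y) i j =
  (entry A i 0 * entry Y 0 j + entry A i 1 * entry Y 1 j)%C.
Proof.
intros Hi Hj; unfold Mmult; unfold entry at 1.
rewrite coeff_mat_bij by assumption.
now cbn [Init.Nat.pred]; rewrite sum_Sn, sum_O.
Qed.

Lemma lin_system_entries (omega delta B : R) (z : C) :
  entry (lin_system omega delta B z) 0 0 = (2 * B / denom omega delta z)%C /\
  entry (lin_system omega delta B z) 0 1 = (1 / denom omega delta z)%C /\
  entry (lin_system omega delta B z) 1 0 = (- (1) / denom omega delta z)%C /\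
  entry (lin_system omega delta B z) 1 1 = (0 / denom omega delta z)%C.
Proof.
unfold lin_system; now rewrite !entry_mk_matrix by auto with arith.
Qed.

(** The zeros of [delta (1 + z^2) - 2 z] are [b = (1 - s) / delta] inside the
    unit circle and [1 / b] outside, where [s = sqrt (1 - delta^2)]; the third
    relation expresses [s] in terms of [b]. *)
Lemma blaschke_parameter (delta : R) :
  0 < delta < 1 ->
  exists b, 0 < b < 1 /\ delta * (1 + b * b) = 2 * b /\
            sqrt (1 - delta ^ 2) * (1 + b * b) = 1 - b * b.
Proof.
intros Hd.
set (s := sqrt (1 - delta ^ 2)).
assert (Hs : 0 < s) by (apply sqrt_lt_R0; nra).
assert (Hs2 : s * s = 1 - delta ^ 2) by (apply sqrt_sqrt; nra).
assert (Hs1 : s < 1) by nra.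
assert (Hb2 : (1 - s) / delta * ((1 - s) / delta) = (1 - s) / (1 + s)).
{ apply Rmult_eq_reg_r with (delta * delta * (1 + s)); [|nra].
  transitivity ((1 - s) * ((1 - s) * (1 + s))); [field; lra|].
  transitivity ((1 - s) * (delta * delta)); [f_equal; lra|field; lra]. }
exists ((1 - s) / delta); split; [split|rewrite Hb2; split].
- apply Rdiv_lt_0_compat; lra.
- apply Rlt_div_l; nra.
- apply Rmult_eq_reg_r with (delta * (1 + s)); [|nra].
  transitivity (delta * delta * 2); [field; lra|].
  replace (delta * delta) with ((1 - s) * (1 + s)) by lra; field; lra.
- field; lra.
Qed.

Lemma denom_factor (omega delta b : R) (z : C) :
  omega <> 0 -> delta * (1 + b * b) = 2 * b ->
  denom omega delta z =
  (- (2 * omega / (1 + b * b))%R * ((z - b) * (1 - b * z)))%C.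
Proof.
intros Ho Hb; unfold denom.
assert (Hn : 1 + b * b <> 0) by nra.
replace delta with (2 * b / (1 + b * b)) by (rewrite <- Hb; field; exact Hn).
rewrite !RtoC_div, !RtoC_mult, !RtoC_plus, !RtoC_mult by exact Hn.
field.
rewrite <- RtoC_mult, <- RtoC_plus; intros E; apply Hn; now injection E.
Qed.

(** Since the denominator is a constant times [(z - b) (1 - b z)], its inverse
    is a constant times the logarithmic derivative of the Blaschke factor. The
    constant, multiplied by an eigenvalue [l], is the exponent of the power
    that solves the equation of that eigenvalue. *)
Lemma inv_denom (omega delta b l : R) (z : C) :
  omega <> 0 -> 0 < b < 1 -> delta * (1 + b * b) = 2 * b ->
  (z - b)%C <> 0 -> (1 - b * z)%C <> 0 ->
  (l / denom omega delta z)%C =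
  ((- l * (1 + b * b) / (2 * omega * (1 - b * b)))%R * logder b z)%C.
Proof.
intros Ho Hb Hd H1 H2; rewrite (denom_factor omega delta b) by assumption.
unfold logder.
assert (Hn : 1 + b * b <> 0) by nra.
assert (Hn' : 1 - b * b <> 0) by nra.
assert (HD : 2 * omega * (1 - b * b) <> 0) by
 (repeat apply Rmult_integral_contrapositive_currified; lra).
rewrite !RtoC_div, !RtoC_mult, !RtoC_minus, !RtoC_opp, !RtoC_plus, !RtoC_mult by assumption.
assert (E1 : (1 + b * b)%C <> 0)
 by (rewrite <- RtoC_mult, <- RtoC_plus; intros E; apply Hn; now injection E).
assert (E2 : (1 - b * b)%C <> 0)
 by (rewrite <- RtoC_mult, <- RtoC_minus; intros E; apply Hn'; now injection E).
assert (E3 : RtoC omega <> 0) by (intros E; apply Ho; now injection E).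
field; repeat split; try assumption.
Qed.

Lemma denom_neq_0 (omega delta b : R) (z : C) :
  omega <> 0 -> delta * (1 + b * b) = 2 * b ->
  (z - b)%C <> 0 -> (1 - b * z)%C <> 0 -> denom omega delta z <> 0.
Proof.
intros Ho Hd H1 H2; rewrite (denom_factor omega delta b) by assumption.
repeat apply Cmult_neq_0; try assumption.
rewrite <- RtoC_opp; intros E; injection E; intros E'.
assert (H : 2 * omega / (1 + b * b) <> 0); [|lra].
apply Rmult_integral_contrapositive_currified; [lra|].
apply Rinv_neq_0_compat; nra.
Qed.

Lemma locally_factors (b t : R) :
  0 < b < 1 ->
  locally (expi t) (fun z => (z - b)%C <> 0 /\ (1 - b * z)%C <> 0).
Proof.
intros Hb; apply (locally_expi _ _ (1 - b)); [lra|]; intros z Hz.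
now destruct (is_derive_branch b t z Hb Hz) as [H1 [H2 _]].
Qed.

(** * Spectral decomposition of the coefficient matrix *)

(** The value at [K = [[2B, 1], [-1, 0]]] of a function that takes the values
    [e1], [e2] at the eigenvalues [l1], [l2] of [K], that is
    [(e1 (K - l2) - e2 (K - l1)) / (l1 - l2)], simplified with
    [l1 + l2 = 2B] and [l1 l2 = 1]. *)
Definition spectral (l1 l2 : R) (e1 e2 : C) : Mat 2 2 :=
  mk_matrix 2 2 (fun i j =>
    (match i, j with
     | O, O => l1 * e1 - l2 * e2
     | O, _ => e1 - e2
     | _, O => e2 - e1
     | _, _ => l1 * e2 - l2 * e1
     end / (l1 - l2))%C).

Lemma spectral_entries (l1 l2 : R) (e1 e2 : C) :
  entry (spectral l1 l2 e1 e2) 0 0 = ((l1 * e1 - l2 * e2) / (l1 - l2))%C /\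
  entry (spectral l1 l2 e1 e2) 0 1 = ((e1 - e2) / (l1 - l2))%C /\
  entry (spectral l1 l2 e1 e2) 1 0 = ((e2 - e1) / (l1 - l2))%C /\
  entry (spectral l1 l2 e1 e2) 1 1 = ((l1 * e2 - l2 * e1) / (l1 - l2))%C.
Proof. unfold spectral; now rewrite !entry_mk_matrix by auto with arith. Qed.

Lemma RtoC_minus_neq_0 (x y : R) : x <> y -> (RtoC x - RtoC y)%C <> 0.
Proof. rewrite <- RtoC_minus; intros H E; apply H; injection E; lra. Qed.

Lemma spectral_1 (l1 l2 : R) (Y : Mat 2 1) :
  l1 <> l2 -> Mmult (spectral l1 l2 1 1) Y = Y.
Proof.
intros Hl; assert (H := RtoC_minus_neq_0 _ _ Hl).
destruct (spectral_entries l1 l2 1 1) as [E00 [E01 [E10 E11]]].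
apply entry_ext; intros i j Hi Hj.
replace j with 0%nat by lia.
rewrite entry_Mmult_2 by lia.
destruct i as [|[|i]]; [| |lia].
- rewrite E00, E01; field; exact H.
- rewrite E10, E11; field; exact H.
Qed.

(** The off-diagonal entries are [(e1 - e2) / (l1 - l2)] up to sign. *)
Lemma spectral_scalar_iff (l1 l2 : R) (e1 e2 : C) :
  l1 <> l2 ->
  (exists c : C, spectral l1 l2 e1 e2 = scalar_matrix 2 c) <-> e1 = e2.
Proof.
intros Hl; assert (H := RtoC_minus_neq_0 _ _ Hl).
destruct (spectral_entries l1 l2 e1 e2) as [E00 [E01 [E10 E11]]].
split.
- intros [c Hc].
  rewrite Hc in E01; unfold scalar_matrix in E01.
  rewrite entry_mk_matrix in E01 by lia; cbn in E01.
  transitivity (e2 + (e1 - e2) / (l1 - l2) * (l1 - l2))%C.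
  + field; exact H.
  + rewrite <- E01; ring.
- intros <-; exists e1; apply entry_ext; intros i j Hi Hj.
  unfold scalar_matrix; rewrite entry_mk_matrix by lia.
  destruct i as [|[|i]]; [| |lia]; (destruct j as [|[|j]]; [| |lia]); cbn [Nat.eqb].
  + rewrite E00; field; exact H.
  + rewrite E01; field; exact H.
  + rewrite E10; field; exact H.
  + rewrite E11; field; exact H.
Qed.

(** For a root [l] of [x^2 - 2 B x + 1] the row vector [(1, l)] is a left
    eigenvector of [K] for the other root [/ l]: hence [eigencoord l2] goes
    with [l1] and [eigencoord l1] with [l2]. *)
Definition eigencoord (l : R) (Y : Mat 2 1) : C :=
  (entry Y 0 0 + l * entry Y 1 0)%C.

(** The two left eigenvectors are independent, so a vector is determined by its
    two eigencoordinates, and [spectral] multiplies them by [e1] and [e2]. *)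
Lemma spectral_unique (l1 l2 : R) (e1 e2 : C) (X Y : Mat 2 1) :
  l1 <> l2 -> l1 * l2 = 1 ->
  eigencoord l2 X = (e1 * eigencoord l2 Y)%C ->
  eigencoord l1 X = (e2 * eigencoord l1 Y)%C ->
  X = Mmult (spectral l1 l2 e1 e2) Y.
Proof.
intros Hl Hprod H2 H1; assert (H := RtoC_minus_neq_0 _ _ Hl).
assert (Hp : (RtoC l1 * RtoC l2)%C = 1) by now rewrite <- RtoC_mult, Hprod.
unfold eigencoord in *.
destruct (spectral_entries l1 l2 e1 e2) as [E00 [E01 [E10 E11]]].
apply entry_ext; intros i j Hi Hj.
replace j with 0%nat by lia.
rewrite entry_Mmult_2 by lia.
set (x0 := entry X 0 0) in *; set (x1 := entry X 1 0) in *.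
set (y0 := entry Y 0 0) in *; set (y1 := entry Y 1 0) in *.
destruct i as [|[|i]]; [| |lia].
- rewrite E00, E01; fold x0.
  transitivity ((l1 * (x0 + l2 * x1) - l2 * (x0 + l1 * x1)) / (l1 - l2))%C;
    [field; exact H|].
  rewrite H1, H2.
  transitivity (((l1 * e1 - l2 * e2) * y0 + (l1 * l2) * (e1 - e2) * y1) / (l1 - l2))%C;
    [field; exact H|].
  rewrite Hp; field; exact H.
- rewrite E10, E11; fold x1.
  transitivity (((x0 + l1 * x1) - (x0 + l2 * x1)) / (l1 - l2))%C;
    [field; exact H|].
  rewrite H1, H2; field; exact H.
Qed.

(** The reason is [(1, l2) K = l1 (1, l2)]. *)
Lemma is_derive_eigencoord (omega delta B l1 l2 : R) (Y : C -> Mat 2 1) (z : C) :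
  l1 + l2 = 2 * B -> l1 * l2 = 1 -> denom omega delta z <> 0 ->
  solves_at (lin_system omega delta B) Y z ->
  is_derive (fun w => eigencoord l2 (Y w)) z
    (l1 / denom omega delta z * eigencoord l2 (Y z))%C.
Proof.
intros Hsum Hprod Hd HY.
assert (Hs : (RtoC 2 * RtoC B)%C = (RtoC l1 + RtoC l2)%C)
  by now rewrite <- RtoC_mult, <- Hsum, RtoC_plus.
assert (Hp : (RtoC l1 * RtoC l2)%C = 1) by now rewrite <- RtoC_mult, Hprod.
destruct (lin_system_entries omega delta B z) as [E00 [E01 [E10 E11]]].
unfold eigencoord.
eapply is_derive_C_eq.
- apply is_derive_C_plus; [|apply is_derive_C_scal]; apply HY; lia.
- rewrite !entry_Mmult_2, E00, E01, E10, E11 by lia.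
  rewrite Hs.
  (* The two sides agree only once the coefficient 1 is read as [l1 * l2]. *)
  transitivity ((l1 * entry (Y z) 0 0 + 1 * entry (Y z) 1 0) / denom omega delta z)%C;
    [field; exact Hd|].
  rewrite <- Hp; field; exact Hd.
Qed.

(** Conversely, solutions of the two scalar equations combine into solutions of
    the system, because [K] acts on [spectral l1 l2 e1 e2] by multiplying [e1]
    by [l1] and [e2] by [l2]. *)
Lemma solves_at_spectral (omega delta B l1 l2 : R) (e1 e2 : C -> C) (y : Mat 2 1) (z : C) :
  l1 <> l2 -> l1 + l2 = 2 * B -> l1 * l2 = 1 -> denom omega delta z <> 0 ->
  is_derive e1 z (l1 / denom omega delta z * e1 z)%C ->
  is_derive e2 z (l2 / denom omega delta z * e2 z)%C ->
  solves_at (lin_system omega delta B)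
    (fun w => Mmult (spectral l1 l2 (e1 w) (e2 w)) y) z.
Proof.
intros Hl Hsum Hprod Hd H1 H2.
assert (H := RtoC_minus_neq_0 _ _ Hl).
assert (Hs : (RtoC 2 * RtoC B)%C = (RtoC l1 + RtoC l2)%C)
  by now rewrite <- RtoC_mult, <- Hsum, RtoC_plus.
assert (Hp : (RtoC l1 * RtoC l2)%C = 1) by now rewrite <- RtoC_mult, Hprod.
destruct (lin_system_entries omega delta B z) as [A00 [A01 [A10 A11]]].
set (y0 := entry y 0 0); set (y1 := entry y 1 0).
assert (U : forall w, entry (Mmult (spectral l1 l2 (e1 w) (e2 w)) y) 0 0 =
  ((l1 * y0 + y1) / (l1 - l2) * e1 w + - (l2 * y0 + y1) / (l1 - l2) * e2 w)%C).
{ intros w; destruct (spectral_entries l1 l2 (e1 w) (e2 w)) as [E00 [E01 _]].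
  rewrite entry_Mmult_2, E00, E01 by lia; fold y0 y1; field; exact H. }
assert (V : forall w, entry (Mmult (spectral l1 l2 (e1 w) (e2 w)) y) 1 0 =
  (- (y0 + l2 * y1) / (l1 - l2) * e1 w + (y0 + l1 * y1) / (l1 - l2) * e2 w)%C).
{ intros w; destruct (spectral_entries l1 l2 (e1 w) (e2 w)) as [_ [_ [E10 E11]]].
  rewrite entry_Mmult_2, E10, E11 by lia; fold y0 y1; field; exact H. }
assert (Hcomb : forall a1 a2 : C,
  is_derive (fun w => a1 * e1 w + a2 * e2 w)%C z
    (a1 * (l1 / denom omega delta z * e1 z) + a2 * (l2 / denom omega delta z * e2 z))%C).
{ intros a1 a2; apply is_derive_C_plus; now apply is_derive_C_scal. }
intros i Hi; rewrite (entry_Mmult_2 1) by lia.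
destruct i as [|[|i]]; [| |lia].
- apply (is_derive_ext _ _ z _ (fun w => eq_sym (U w))).
  eapply is_derive_C_eq; [apply Hcomb|].
  rewrite A00, A01, U, V, Hs.
  (* With [l1 * l2] in place of 1 the claim is a polynomial identity. *)
  transitivity (((l1 + l2) * ((l1 * y0 + y1) * e1 z - (l2 * y0 + y1) * e2 z)
     + ((y0 * - (l1 * l2) - l2 * y1) * e1 z + (y0 * (l1 * l2) + l1 * y1) * e2 z))
     / (l1 - l2) / denom omega delta z)%C; [field; split; assumption|].
  rewrite Hp; field; split; assumption.
- apply (is_derive_ext _ _ z _ (fun w => eq_sym (V w))).
  eapply is_derive_C_eq; [apply Hcomb|].
  rewrite A10, A11, U, V.
  transitivity ((- (l1 * y0 + l1 * l2 * y1) * e1 z + (l2 * y0 + l1 * l2 * y1) * e2 z)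
     / (l1 - l2) / denom omega delta z)%C; [field; split; assumption|].
  rewrite Hp; field; split; assumption.
Qed.

(** * The monodromy *)

(** The exponent attached to the eigenvalue [l]; it equals [- l / (2 omega s)]
    with [s = (1 - b^2) / (1 + b^2)]. *)
Definition exponent (omega b l : R) : R :=
  - l * (1 + b * b) / (2 * omega * (1 - b * b)).

(** The two eigencoordinates of a continued solution behave like powers of the
    Blaschke factor, and the [m]-th power is multiplied by [exp (2 i PI m)]. *)
Lemma is_monodromy_spectral (omega delta B b l1 l2 : R) :
  omega <> 0 -> 0 < b < 1 -> delta * (1 + b * b) = 2 * b ->
  l1 <> l2 -> l1 + l2 = 2 * B -> l1 * l2 = 1 ->
  is_monodromy (lin_system omega delta B) expi 0 (2 * PI)
    (spectral l1 l2 (expi (exponent omega b l1 * (2 * PI)))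
                    (expi (exponent omega b l2 * (2 * PI)))).
Proof.
intros Ho Hb Hdb Hl Hsum Hprod.
assert (HPI := PI_RGT_0).
split; [now rewrite expi_0, expi_2PI|split].
- intros y.
  exists (fun t z => Mmult (spectral l1 l2
            (power b (exponent omega b l1) t z)
            (power b (exponent omega b l2) t z)) y).
  split; [split|].
  + intros t _.
    generalize (filter_and _ _ (locally_factors b t Hb)
      (filter_and _ _ (is_derive_power b (exponent omega b l1) t Hb)
                      (is_derive_power b (exponent omega b l2) t Hb))).
    apply filter_imp; intros z [[N1 N2] [D1 D2]].
    apply solves_at_spectral; try assumption.
    * now apply (denom_neq_0 omega delta b).
    * now rewrite (inv_denom omega delta b) by assumption.
    * now rewrite (inv_denom omega delta b) by assumption.
  + intros t _; exists (PI / 2); split; [lra|].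
    intros s _ Hst.
    generalize (filter_and _ _ (power_near b (exponent omega b l1) s t Hst)
                               (power_near b (exponent omega b l2) s t Hst)).
    apply filter_imp; intros z [E1 E2]; now rewrite E1, E2.
  + unfold power; rewrite expi_0, branch_start.
    rewrite !Cmult_0_r, cexp_0; now apply spectral_1.
- intros Y [Hsol Hcont].
  assert (Hc : forall l l', l + l' = 2 * B -> l * l' = 1 ->
    eigencoord l' (Y (2 * PI) (expi (2 * PI))) =
    (expi (exponent omega b l * (2 * PI))%R * eigencoord l' (Y 0%R (expi 0%R)))%C).
  { intros l l' Hs Hp.
    apply (scalar_monodromy b (exponent omega b l)
             (fun t z => eigencoord l' (Y t z))); [exact Hb| |].
    - intros t Ht.
      generalize (filter_and _ _ (locally_factors b t Hb) (Hsol t Ht)).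
      apply filter_imp; intros z [[N1 N2] HY].
      unfold exponent; rewrite <- (inv_denom omega delta b l) by assumption.
      apply (is_derive_eigencoord omega delta B l l'); try assumption.
      now apply (denom_neq_0 omega delta b).
    - intros t Ht; destruct (Hcont t Ht) as [eta [Heta HY]].
      exists eta; split; [exact Heta|]; intros s Hs' Hst.
      generalize (HY s Hs' Hst); apply filter_imp; intros z E; now rewrite E. }
  apply spectral_unique; [exact Hl|exact Hprod| |].
  + now apply Hc.
  + apply Hc; lra.
Qed.

(** Each initial vector is the value of a continued solution, whose final value
    does not mention the matrix. *)
Lemma is_monodromy_unique (A : C -> Mat 2 2) (gamma : R -> C) (a b : R) (M N : Mat 2 2) :
  is_monodromy A gamma a b M -> is_monodromy A gamma a b N -> M = N.
Proof.
intros [_ [Hex HM]] [_ [_ HN]].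
assert (HMN : forall y : Mat 2 1, Mmult M y = Mmult N y).
{ intros y; destruct (Hex y) as [Y [HY <-]].
  now rewrite <- (HM Y HY), <- (HN Y HY). }
pose (e := fun k => mk_matrix 2 1
             (fun i _ => if Nat.eqb i k then RtoC 1 else RtoC 0) : Mat 2 1).
assert (He : forall (P : Mat 2 2) i k, (i < 2)%nat -> (k < 2)%nat ->
  entry P i k = entry (Mmult P (e k)) i 0).
{ intros P i k Hi Hk; rewrite entry_Mmult_2 by lia.
  unfold e; rewrite !entry_mk_matrix by lia.
  destruct k as [|[|k]]; [| |lia]; cbn [Nat.eqb]; ring. }
apply entry_ext; intros i k Hi Hk.
now rewrite !He, HMN by assumption.
Qed.

Theorem theorem26 (omega delta B : R)
    (Homega : omega <> 0) (Hdelta : 0 < delta < 1) (HB : 1 < B) :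
  (exists M : Mat 2 2,
     is_monodromy (lin_system omega delta B) expi 0 (2 * PI) M) /\
  (forall M : Mat 2 2,
     is_monodromy (lin_system omega delta B) expi 0 (2 * PI) M ->
     ((exists c : C, M = scalar_matrix 2 c) <->
      (exists n : Z,
         B ^ 2 = omega ^ 2 * (1 - delta ^ 2) * (IZR n) ^ 2 + 1))).
Proof.
destruct (blaschke_parameter delta Hdelta) as [b [Hb [Hdb Hsb]]].
set (s := sqrt (1 - delta ^ 2)) in *.
assert (Hs : 0 < s) by (apply sqrt_lt_R0; nra).
assert (Hs2 : s ^ 2 = 1 - delta ^ 2) by (apply pow2_sqrt; nra).
set (r := sqrt (B ^ 2 - 1)).
assert (Hr : 0 < r) by (apply sqrt_lt_R0; nra).
assert (Hr2 : r ^ 2 = B ^ 2 - 1) by (apply pow2_sqrt; nra).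
assert (Hl : B + r <> B - r) by lra.
assert (HM0 := is_monodromy_spectral omega delta B b (B + r) (B - r)
  Homega Hb Hdb Hl ltac:(ring) ltac:(nra)).
split; [eexists; exact HM0|].
intros M HM; rewrite (is_monodromy_unique _ _ _ _ _ _ HM HM0).
rewrite spectral_scalar_iff, expi_eq_iff by exact Hl.
(* The two exponents differ by [- (l1 - l2) / (2 omega s)] with
   [l1 - l2 = 2 r], and the multipliers agree when this is an integer. *)
assert (E : exponent omega b (B + r) * (2 * PI) - exponent omega b (B - r) * (2 * PI)
            = 2 * PI * (- r / (omega * s))).
{ unfold exponent; rewrite <- Hsb.
  assert (1 + b * b <> 0) by nra.
  field; repeat split; lra. }
rewrite E; clear E.
assert (HPI := PI_RGT_0).
rewrite <- Hs2.
split.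
- intros [n Hn]; exists n.
  apply Rmult_eq_reg_l in Hn; [|lra].
  rewrite <- Hn.
  replace (B ^ 2) with (r ^ 2 + 1) by lra.
  field; lra.
- intros [n Hn].
  assert (Hsq : (r - omega * s * IZR n) * (r + omega * s * IZR n) = 0) by nra.
  apply Rmult_integral in Hsq; destruct Hsq as [H|H].
  (* The equation only fixes [r] up to sign, as [n] and [omega] are signed. *)
  + exists (- n)%Z; rewrite opp_IZR; f_equal.
    replace r with (omega * s * IZR n) by lra; field; lra.
  + exists n; f_equal.
    replace r with (- (omega * s * IZR n)) by lra; field; lra.
Qed.
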